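(* Let $f\colon\mathbb{R}^d\to\mathbb{R}$ be a continuously differentiable convex function with unique minimizer $x^*$, and let $h\colon\mathbb{R}^d\to\mathbb{R}$ be a distance-generating function. Let $\mathbb{T}\subseteq\mathbb{R}$ be an interval and let $\alpha,\beta,\gamma\colon\mathbb{T}\to\mathbb{R}$ be continuously differentiable functions satisfying the ideal scaling conditions $$\dot\beta_t\le e^{\alpha_t},\qquad \dot\gamma_t=e^{\alpha_t}\qquad(t\in\mathbb{T}).$$ Let $X\colon\mathbb{T}\to\mathbb{R}^d$, $t\mapsto X_t$, be a twice continuously differentiable curve satisfying the equation $$\frac{d}{dt}\nabla h\big(X_t+e^{-\alpha_t}\dot X_t\big)=-e^{\alpha_t+\beta_t}\,\nabla f(X_t)\qquad(t\in\mathbb{T}),$$ which, under the condition $\dot\gamma_t=e^{\alpha_t}$, is the Euler-Lagrange equation of the Bregman Lagrangian with parameters $\alpha,\beta,\gamma$. Then $$f(X_t)-f(x^* )\le O(e^{-\beta_t}),$$ that is, for every $t_0\in\mathbb{T}$ there is a constant $K\ge 0$ such that $f(X_t)-f(x^* )\le K e^{-\beta_t}$ for all $t\in\mathbb{T}$ with $t\ge t_0$.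
   Context: The distance-generating function $h\colon\mathbb{R}^d\to\mathbb{R}$ is convex and essentially smooth, meaning that $h$ is continuously differentiable and $\|\nabla h(x)\|\to\infty$ as $\|x\|\to\infty$; moreover $\nabla h$ is assumed differentiable. The Bregman divergence of $h$ is $D_h(y,x)=h(y)-h(x)-\langle\nabla h(x),y-x\rangle$. The Bregman Lagrangian with parameters $\alpha,\beta,\gamma$ is $\mathcal{L}(X,V,t)=e^{\alpha_t+\gamma_t}\big(D_h(X+e^{-\alpha_t}V,X)-e^{\beta_t}f(X)\big)$, for position $X\in\mathbb{R}^d$, velocity $V\in\mathbb{R}^d$ and time $t\in\mathbb{T}$. A dot denotes the derivative with respect to $t$. *)

(* Defs.v *)
From HB Require Import structures.
From mathcomp Require Import all_boot all_order all_algebra.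
From mathcomp Require Import all_classical all_reals all_analysis.

Set Implicit Arguments.
Unset Strict Implicit.
Unset Printing Implicit Defensive.

Import Order.TTheory GRing.Theory Num.Theory.
Import numFieldNormedType.Exports.

Local Open Scope classical_set_scope.
Local Open Scope ring_scope.

Section Euclidean.
Context {R : realType} {d : nat}.
Implicit Types (u v x y : 'rV[R]_d) (f h : 'rV[R]_d -> R).

Definition inner u v : R := \sum_(i < d) u 0 i * v 0 i.

(* The library norm on 'rV[R]_d is the sup norm. *)
Definition enorm u : R := Num.sqrt (inner u u).

Definition grad f x : 'rV[R]_d := \row_(i < d) 'D_(delta_mx 0 i) f x.

Definition C1 f : Prop :=
  (forall x, differentiable f x) /\ continuous (grad f).

Definition unique_minimizer f x : Prop :=
  (forall y, f x <= f y) /\ (forall z, (forall y, f z <= f y) -> z = x).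

Definition essentially_smooth h : Prop :=
  C1 h /\
  (forall M : R, exists r : R, forall x, r <= enorm x -> M <= enorm (grad h x)).

Definition distance_generating h : Prop :=
  [/\ convex_function [set: 'rV[R]_d] h, essentially_smooth h &
      forall x, differentiable (grad h) x].

Definition bregman_div h y x : R := h y - h x - inner (grad h x) (y - x).

End Euclidean.

(* Differentiation with respect to time relative to a set T of times: at an
   endpoint of an interval T the derivative is one-sided, and only the values
   on T matter. *)
Section DeriveWithin.
Context {R : realType} {V : normedModType R}.
Implicit Types (T : set R) (g : R -> V) (t : R) (v : V).

Definition is_derive_within T g t v : Prop :=
  (s - t)^-1 *: (g s - g t) @[s --> within T t^'] --> v.

Definition derivable_within T g t : Prop :=
  cvg ((s - t)^-1 *: (g s - g t) @[s --> within T t^']).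

Definition derive_within T g t : V :=
  lim ((s - t)^-1 *: (g s - g t) @[s --> within T t^']).

Definition C1_within T g : Prop :=
  (forall t, T t -> derivable_within T g t) /\
  {within T, continuous (derive_within T g)}.

Definition C2_within T g : Prop :=
  (forall t, T t -> derivable_within T g t) /\
  C1_within T (derive_within T g).

End DeriveWithin.

Section Bregman.
Context {R : realType} {d : nat}.
Implicit Types (f h : 'rV[R]_d -> R) (alpha beta gamma : R -> R).
Implicit Types (T : set R) (X : R -> 'rV[R]_d).

Definition bregman_lagrangian f h alpha beta gamma
    (Y V : 'rV[R]_d) (t : R) : R :=
  expR (alpha t + gamma t) *
    (bregman_div h (Y + expR (- alpha t) *: V) Y - expR (beta t) * f Y).

Definition euler_lagrange T (L : 'rV[R]_d -> 'rV[R]_d -> R -> R) X : Prop :=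
  let dX := derive_within T X in
  forall t, T t ->
    is_derive_within T (fun s => grad (fun V => L (X s) V s) (dX s)) t
      (grad (fun Y => L Y (dX t) t) (X t)).

Definition bregman_flow T f h alpha beta X : Prop :=
  let dX := derive_within T X in
  forall t, T t ->
    is_derive_within T
      (fun s => grad h (X s + expR (- alpha s) *: dX s)) t
      (- (expR (alpha t + beta t) *: grad f (X t))).

End Bregman.

(* Main.v *)
(* The energy E_t = D_h(xstar, Z_t) + e^beta (f(X_t) - f(xstar)), with
   Z_t = X_t + e^(-alpha) X'_t, does not increase along the flow, and the Bregman
   divergence is nonnegative, so K = E_(t0) works.

   For the Euler-Lagrange equation, the momentum is e^gamma (grad h(Z) - grad h(X)).
   Its time derivative produces the Hessian of h applied to X', whereas the position
   gradient of the Lagrangian produces the transposed Hessian; they agree because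
   the Hessian of a twice differentiable function is symmetric. All the remaining
   terms match exactly when the flow equation holds. *)
Require Import Defs.
From HB Require Import structures.
From mathcomp Require Import all_boot all_order all_algebra.
From mathcomp Require Import all_classical all_reals all_analysis.
From mathcomp Require Import ring lra.
Import Order.TTheory GRing.Theory Num.Theory.
Import numFieldNormedType.Exports.
Local Open Scope classical_set_scope.
Local Open Scope ring_scope.

Set Implicit Arguments.
Unset Strict Implicit.

(** * Calculus of derivatives relative to a set of times *)

Section DeriveWithinTheory.
Context {R : realType}.
Implicit Types (V W : normedModType R) (T : set R) (t : R).

(** Membership [T t] matters because the value at [t] itself enters every difference quotient. *)
Lemma is_derive_within_eq V T (g1 g2 : R -> V) t v :
  T t -> (forall s, T s -> g1 s = g2 s) ->
  is_derive_within T g1 t v -> is_derive_within T g2 t v.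
Proof.
move=> Tt e; rewrite /is_derive_within; apply: cvg_trans; apply: near_eq_cvg.
by rewrite near_withinE; near=> s => Ts; rewrite !e.
Unshelve. all: by end_near. Qed.

(** Differentiability forces continuity: [g s] is [g t] plus [s - t] times the difference quotient,
    and a vanishing factor times a convergent one tends to 0. *)
Lemma is_derive_within_cvg V T (g : R -> V) t v :
  is_derive_within T g t v -> g s @[s --> within T t^'] --> g t.
Proof.
move=> dg.
have s_to_t : (s - t) @[s --> within T t^'] --> (0 : R).
  have tt : s @[s --> within T t^'] --> t.
    move=> A tA; rewrite /= nbhs_simpl /within /= /dnbhs /= /within /=.
    by apply: filterS tA => s ? _ _.
  by rewrite -(subrr t); apply: cvgB => //; exact: cvg_cst.
have : (s - t) *: ((s - t)^-1 *: (g s - g t)) + g t @[s --> within T t^'] --> 0 *: v + g t.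
  by apply: cvgD; [exact: cvgZ|exact: cvg_cst].
rewrite scale0r add0r; apply: cvg_trans; apply: near_eq_cvg.
rewrite !near_withinE; near=> s => st _.
by rewrite scalerA divff ?subr_eq0// scale1r subrK.
Unshelve. all: by end_near. Qed.

Lemma is_derive_within_cst V T (c : V) t : is_derive_within T (fun=> c) t 0.
Proof.
rewrite /is_derive_within; under eq_fun do rewrite subrr scaler0.
exact: cvg_cst.
Qed.

Lemma is_derive_within_id T t : is_derive_within T id t (1 : R).
Proof.
have : (cst 1 : R -> R) s @[s --> within T t^'] --> (1 : R) by exact: cvg_cst.
apply: cvg_trans; apply: near_eq_cvg.
rewrite !near_withinE; near=> s => st _.
by rewrite -[X in _ = X]/((s - t)^-1 * (s - t)) mulVf// subr_eq0.
Unshelve. all: by end_near. Qed.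

Lemma is_derive_withinD V T (g1 g2 : R -> V) t v1 v2 :
  is_derive_within T g1 t v1 -> is_derive_within T g2 t v2 ->
  is_derive_within T (fun s => g1 s + g2 s) t (v1 + v2).
Proof.
move=> d1 d2; rewrite /is_derive_within.
under eq_fun do rewrite opprD addrACA scalerDr.
exact: cvgD.
Qed.

Lemma is_derive_withinN V T (g : R -> V) t v :
  is_derive_within T g t v -> is_derive_within T (fun s => - g s) t (- v).
Proof.
move=> d1; rewrite /is_derive_within.
under eq_fun do rewrite -opprD scalerN.
exact: cvgN.
Qed.

Lemma is_derive_withinB V T (g1 g2 : R -> V) t v1 v2 :
  is_derive_within T g1 t v1 -> is_derive_within T g2 t v2 ->
  is_derive_within T (fun s => g1 s - g2 s) t (v1 - v2).
Proof. by move=> d1 d2; apply: is_derive_withinD => //; exact: is_derive_withinN. Qed.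

Lemma is_derive_withinZ V T (k : R -> R) (g : R -> V) t k' v :
  is_derive_within T k t k' -> is_derive_within T g t v ->
  is_derive_within T (fun s => k s *: g s) t (k t *: v + k' *: g t).
Proof.
move=> dk dg; rewrite /is_derive_within.
have := is_derive_within_cvg dk => kt.
(* Leibniz splitting with [k] evaluated at the moving point [s] in the first term, hence the appeal
   to continuity of [k] at [t]. *)
rewrite (_ : (fun s => _) = (fun s => k s *: ((s - t)^-1 *: (g s - g t)) +
   ((s - t)^-1 *: (k s - k t)) *: g t)); last first.
  apply/funext => s; set c := _^-1.
  rewrite -[(c *: (k s - k t)) *: g t]scalerA.
  rewrite [k s *: (c *: _)]scalerA [k s * c]mulrC -[(c * k s) *: _]scalerA -scalerDr.
  by congr (_ *: _); rewrite scalerBr scalerBl addrA subrK.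
by apply: cvgD; apply: cvgZ => //; exact: cvg_cst.
Qed.

Lemma is_derive_withinM T (k g : R -> R) t k' g' :
  is_derive_within T k t k' -> is_derive_within T g t g' ->
  is_derive_within T (fun s => k s * g s) t (k t * g' + k' * g t).
Proof. exact: is_derive_withinZ. Qed.

Lemma is_derive_within_sum V T (I : Type) (r : seq I) (g : I -> R -> V) t v :
  (forall i, is_derive_within T (g i) t (v i)) ->
  is_derive_within T (fun s => \sum_(i <- r) g i s) t (\sum_(i <- r) v i).
Proof.
move=> dg; elim: r => [|i r IH].
  rewrite big_nil; under eq_fun do rewrite big_nil.
  exact: is_derive_within_cst.
rewrite big_cons; under eq_fun do rewrite big_cons.
exact: is_derive_withinD.
Qed.

(** Chain rule: the Fréchet expansion of [F] at [g t] splits the quotient into ['d F] of the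
    quotient of [g], which converges by continuity of ['d F], and a remainder, which vanishes
    because the quotient of [g] stays bounded. *)
Lemma is_derive_within_comp V W T (g : R -> V) (F : V -> W) t v :
  is_derive_within T g t v -> differentiable F (g t) ->
  is_derive_within T (fun s => F (g s)) t ('d F (g t) v).
Proof.
move=> dg dF; have gt := is_derive_within_cvg dg.
have /diff_locally := dF; set k := 'o _ => Fk.
have Fs s : F (g s) - F (g t) = 'd F (g t) (g s - g t) + k (g s - g t).
  have := congr1 (fun G => G (g s - g t)) Fk; rewrite /= subrK => ->.
  by rewrite -[X in X - _]/(F (g t) + 'd F (g t) _ + k _) -[X in X - _]addrA [LHS]addrC addKr.
rewrite /is_derive_within; under eq_fun do rewrite Fs scalerDr -linearZ/=.
rewrite -['d F (g t) v]addr0; apply: cvgD.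
  by apply: (cvg_comp _ _ dg); exact: (diff_continuous dF).
apply/cvgr0Pnorm_le => e e0.
(* [C] eventually bounds the quotient of [g], so the little-o estimate with constant [e / C] leaves
   exactly [e]. *)
pose C := `|v| + 1; have C0 : 0 < C by rewrite ltr_pwDr.
have /(littleoP [littleo of k]) ke : 0 < e / C by rewrite divr_gt0.
have g0 : (g s - g t) @[s --> within T t^'] --> (0 : V).
  by rewrite -(subrr (g t)); apply: cvgB => //; exact: cvg_cst.
have /= {}ke := g0 _ ke.
have qC : \forall s \near within T t^', `|(s - t)^-1 *: (g s - g t)| <= C.
  by apply: (@cvgr_norm_le _ _ _ _ _ _ v); rewrite ?ltrDl.
near=> s.
have kes : `|k (g s - g t)| <= e / C * `|g s - g t| by near: s; exact: ke.
have qs : `|(s - t)^-1 *: (g s - g t)| <= C by near: s.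
rewrite normrZ; apply: le_trans (ler_wpM2l (normr_ge0 _) kes) _.
rewrite mulrCA -normrZ; apply: le_trans (ler_wpM2l _ qs) _; first by rewrite ltW ?divr_gt0.
by rewrite divfK// gt_eqF.
Unshelve. all: by end_near. Qed.

Lemma is_derive_within_expR T (g : R -> R) t g' :
  is_derive_within T g t g' ->
  is_derive_within T (fun s => expR (g s)) t (expR (g t) * g').
Proof.
move=> dg.
have dE : differentiable (expR : R -> R) (g t) by apply/derivable1_diffP; exact: ex_derive.
suff <- : 'd (expR : R -> R) (g t) g' = expR (g t) * g' by exact: is_derive_within_comp.
have {1}-> : g' = g' *: (1 : R) by exact/esym/mulr1.
by rewrite linearZ -deriveE// derive_val mulrC.
Qed.

(** Bridge to directional derivatives: they are relative derivatives, at time 0, along the line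
    through [a] directed by [v]. *)
Lemma is_deriveP V W (F : V -> W) a v l :
  is_derive a v F l <-> is_derive_within setT (fun s => F (s *: v + a)) 0 l.
Proof.
have -> : is_derive_within setT (fun s => F (s *: v + a)) 0 l =
    ((fun h => h^-1 *: ((F \o shift a) (h *: v) - F a)) @ 0^' --> l).
  have wT : within setT (0 : R)^' = (0 : R)^'.
    apply/funext => A; apply/propext; rewrite /within /=.
    by split; apply: filterS => x //=; apply.
  by rewrite /is_derive_within wT scale0r add0r; under eq_fun do rewrite subr0.
split=> [[dF <-]//|Fl]; split; first by apply/cvg_ex; exists l.
exact: (cvg_lim _ Fl).
Qed.

(** Near an interior point the constraint [T s] holds automatically, so the relative derivative is
    the ordinary one and the mean value theorem becomes available. *)
Lemma is_derive_within_interior V T (g : R -> V) t v :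
  T° t -> is_derive_within T g t v -> is_derive t 1 g v.
Proof.
move=> Tt dg.
have sh : (h + t) @[h --> (0 : R)^'] --> within T t^'.
  move=> A /=; rewrite /within /= /dnbhs /= => tA.
  have : \forall s \near t, s != t -> A s.
    by apply: filterS2 Tt tA => s Ts + st; exact.
  rewrite (near_shift 0) subr0; apply: filterS => s /= + s0; apply.
  by rewrite -subr_eq0 addrK.
have gv := cvg_comp _ _ sh dg.
have {gv} : h^-1 *: (g (h *: 1 + t) - g t) @[h --> 0^'] --> v.
  move: gv; rewrite /comp/=.
  by under eq_fun do rewrite addrK -[X in g (X + _)]mulr1.
move=> gv; split; first by apply/cvg_ex; exists v.
exact: (cvg_lim _ gv).
Qed.

End DeriveWithinTheory.

Arguments is_derive_within_cst {R V} T c t.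
Arguments is_derive_within_id {R} T t.

(** * Inner product and gradients *)

Section EuclideanTheory.
Context {R : realType} {d : nat}.
Implicit Types (u v x y : 'rV[R]_d) (f h : 'rV[R]_d -> R).

Lemma innerC u v : inner u v = inner v u.
Proof. by apply: eq_bigr => i _; rewrite mulrC. Qed.

Lemma innerDr u v1 v2 : inner u (v1 + v2) = inner u v1 + inner u v2.
Proof. by rewrite -big_split; apply: eq_bigr => i _; rewrite mxE mulrDr. Qed.

Lemma innerZr (c : R) u v : inner u (c *: v) = c * inner u v.
Proof. by rewrite mulr_sumr; apply: eq_bigr => i _; rewrite mxE mulrCA. Qed.

Lemma innerNr u v : inner u (- v) = - inner u v.
Proof. by rewrite -scaleN1r innerZr mulN1r. Qed.

Lemma innerBr u v1 v2 : inner u (v1 - v2) = inner u v1 - inner u v2.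
Proof. by rewrite innerDr innerNr. Qed.

Lemma innerDl u1 u2 v : inner (u1 + u2) v = inner u1 v + inner u2 v.
Proof. by rewrite innerC innerDr !(innerC v). Qed.

Lemma innerZl (c : R) u v : inner (c *: u) v = c * inner u v.
Proof. by rewrite innerC innerZr (innerC v). Qed.

Lemma innerNl u v : inner (- u) v = - inner u v.
Proof. by rewrite innerC innerNr innerC. Qed.

Lemma innerBl u1 u2 v : inner (u1 - u2) v = inner u1 v - inner u2 v.
Proof. by rewrite innerDl innerNl. Qed.

Lemma inner0r u : inner u 0 = 0.
Proof. by rewrite -(scale0r u) innerZr mul0r. Qed.

Lemma inner0l u : inner 0 u = 0.
Proof. by rewrite innerC inner0r. Qed.

Lemma inner_delta u i : inner u (delta_mx 0 i) = u 0 i.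
Proof.
rewrite /inner (bigD1 i)//= mxE !eqxx mulr1 big1 ?addr0// => j ji.
by rewrite mxE (negbTE ji) mulr0.
Qed.

Lemma normr_coord_le u i : `|u 0 i| <= `|u|.
Proof.
rewrite [leRHS]/Num.norm/= mx_normrE.
exact: (le_bigmax 0 (fun ij => `|u ij.1 ij.2|) (0, i)).
Qed.

(** A Cauchy-Schwarz substitute for the sup norm: each of the [d] terms is at most the product of
    the norms. The factor [d] is later absorbed into an epsilon. *)
Lemma normr_inner_le u v : `|inner u v| <= d%:R * `|u| * `|v|.
Proof.
apply: le_trans (ler_norm_sum _ _ _) _.
apply: (@le_trans _ _ (\sum_(i < d) `|u| * `|v|)).
  by apply: ler_sum => i _; rewrite normrM ler_pM ?normr_coord_le.
by rewrite sumr_const card_ord -mulrA mulr_natl.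
Qed.

Lemma is_derive_within_coord (T : set R) (g : R -> 'rV[R]_d) t v i :
  is_derive_within T g t v -> is_derive_within T (fun s => g s 0 i) t (v 0 i).
Proof.
move=> dg; have := cvg_comp _ _ dg (@coord_continuous R 1 d 0 i v).
rewrite /is_derive_within; apply: cvg_trans; apply: near_eq_cvg; near=> s.
by rewrite /= !mxE.
Unshelve. all: by end_near. Qed.

Lemma is_derive_within_inner (T : set R) (g1 g2 : R -> 'rV[R]_d) t v1 v2 :
  is_derive_within T g1 t v1 -> is_derive_within T g2 t v2 ->
  is_derive_within T (fun s => inner (g1 s) (g2 s)) t
    (inner (g1 t) v2 + inner v1 (g2 t)).
Proof.
move=> d1 d2; rewrite /inner -big_split; apply: is_derive_within_sum => i.
by apply: is_derive_withinM; exact: is_derive_within_coord.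
Qed.

(** Expanding [v] in the standard basis turns the differential into the sum of partial derivatives
    defining [grad]. *)
Lemma diff_grad f x v : differentiable f x -> 'd f x v = inner (grad f x) v.
Proof.
move=> df; rewrite {1}[v]row_sum_delta linear_sum; apply: eq_bigr => i _.
by rewrite linearZ mxE -deriveE// mulrC.
Qed.

Lemma is_derive_within_grad (T : set R) (g : R -> 'rV[R]_d) f t v :
  differentiable f (g t) -> is_derive_within T g t v ->
  is_derive_within T (fun s => f (g s)) t (inner (grad f (g t)) v).
Proof.
by move=> df dg; rewrite -diff_grad//; exact: is_derive_within_comp.
Qed.

(** Reads a gradient off the derivatives along lines; the partial gradients of the Lagrangian are
    computed this way. *)
Lemma grad_eq f x u :
  (forall v, is_derive_within setT (fun s => f (s *: v + x)) 0 (inner u v)) ->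
  grad f x = u.
Proof.
move=> fu; apply/rowP => i; rewrite mxE -(inner_delta u).
by have /is_deriveP[_ ] := fu (delta_mx 0 i).
Qed.

Lemma is_derive_within_line (T : set R) (x v : 'rV[R]_d) t :
  is_derive_within T (fun s => s *: v + x) t v.
Proof.
have := is_derive_withinD (is_derive_withinZ (is_derive_within_id T t)
  (is_derive_within_cst T v t)) (is_derive_within_cst T x t).
by rewrite scaler0 add0r scale1r addr0.
Qed.

(** * Second differences, symmetry of the Hessian, and the convexity inequality *)

Lemma MVT_line (f : R -> R) (f' : R -> R) (a b : R) : a < b ->
  (forall t, is_derive_within setT f t (f' t)) ->
  exists2 c, a < c < b & f b - f a = f' c * (b - a).
Proof.
move=> ab df.
have {}df (t : R) : is_derive t 1 f (f' t).
  by apply: is_derive_within_interior (df t); rewrite interiorT.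
have cf : {within `[a, b], continuous f}.
  apply: continuous_subspaceT => t; apply: differentiable_continuous.
  by apply/derivable1_diffP; have [] := df t.
have [c + fc] := MVT ab (fun t _ => df t) cf.
by rewrite in_itv/=; exists c.
Qed.

(** The mean value theorem in the direction [u] reduces the second difference to a difference of
    gradients at two points within O(t) of [x]; expanding [grad h] to first order at [x] alone then
    leaves an o(t^2) error. *)
Lemma second_difference h x u v (e : R) :
  (forall y, differentiable h y) -> differentiable (grad h) x -> 0 < e ->
  \forall t \near 0^'+,
    `|h (t *: u + (t *: v + x)) - h (t *: u + x) - h (t *: v + x) + h x
      - t ^+ 2 * inner ('d (grad h) x v) u| <= e * t ^+ 2.
Proof.
move=> dh dgh e0.
set H := 'd (grad h) x.
have /diff_locally := dgh; set k := 'o _ => gk.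
have {}gk y : grad h (y + x) = grad h x + H y + k y.
  exact: (congr1 (fun G => G y) gk).
(* For [0 < c < t], both [c *: u + t *: v] and [c *: u] have norm at most [t * B]; the added 1 makes
   [B] positive even when [u] and [v] vanish. *)
set B := `|u| + `|v| + 1.
have B0 : 0 < B by rewrite ltr_wpDl ?addr_ge0.
(* Two remainders of size [e' * (t * B)], paired with [u], must total at most [e * t]; the [+ 1]
   keeps the denominator positive. *)
set e' := e / (d%:R * 2 * B * `|u| + 1).
have D0 : 0 < d%:R * 2 * B * `|u| + 1 by rewrite ltr_wpDl// !mulr_ge0// ltW.
have e'0 : 0 < e' by rewrite divr_gt0.
have /(littleoP [littleo of k]) /nbhs_ballP[r /= r0 kr] := e'0.
have {}kr y : `|y| < r -> `|k y| <= e' * `|y|.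
  by move=> yr; apply: kr; rewrite -ball_normE/= sub0r normrN.
near=> t.
have t0 : 0 < t by near: t; exact: nbhs_right_gt.
have tr : t * B < r.
  by rewrite -ltr_pdivlMr//; near: t; apply: nbhs_right_lt; rewrite divr_gt0.
have ktB y : `|y| <= t * B -> `|k y| <= e' * (t * B).
  move=> ytB; apply: le_trans (kr _ (le_lt_trans ytB tr)) _.
  by rewrite ler_wpM2l// ltW.
(* The expected Hessian term is subtracted as a linear function of [s], so that [phi t - phi 0] is
   exactly the quantity to bound. *)
pose phi s := h (s *: u + (t *: v + x)) - h (s *: u + x) - s * (t * inner (H v) u).
pose phi' s := inner (grad h (s *: u + (t *: v + x))) u
  - inner (grad h (s *: u + x)) u - (s * 0 + 1 * (t * inner (H v) u)).
have dphi s : is_derive_within setT phi s (phi' s).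
  apply: is_derive_withinB.
    by apply: is_derive_withinB; apply: is_derive_within_grad => //;
      exact: is_derive_within_line.
  by apply: is_derive_withinM; [exact: is_derive_within_id|exact: is_derive_within_cst].
have [c /andP[c0 ct] phic] := MVT_line t0 dphi.
have -> : h (t *: u + (t *: v + x)) - h (t *: u + x) - h (t *: v + x) + h x
      - t ^+ 2 * inner (H v) u = phi t - phi 0.
  rewrite /phi !scale0r !add0r; ring.
have tB1 : `|c *: u + t *: v| <= t * B.
  apply: le_trans (ler_normD _ _) _; rewrite !normrZ !gtr0_norm//.
  rewrite /B !mulrDr mulr1 -[leLHS]addr0; apply: lerD; last exact: ltW.
  by apply: lerD => //; rewrite ler_wpM2r// ltW.
have tB2 : `|c *: u| <= t * B.
  rewrite normrZ gtr0_norm// /B -addrA mulrDr -[leLHS]addr0; apply: lerD.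
    by rewrite ler_wpM2r// ltW.
  by rewrite mulr_ge0 ?addr_ge0// ltW.
(* In the expansion of both gradients, [grad h x] cancels and the linear parts differ by [t *: H v],
   which the subtracted term removes; only the remainders survive. *)
have -> : phi t - phi 0 = inner (k (c *: u + t *: v) - k (c *: u)) u * t.
  rewrite phic subr0 /phi' addrA !gk; congr (_ * _).
  rewrite linearD /= !linearZ /= innerBl !innerDl !innerZl; ring.
rewrite normrM (gtr0_norm t0) expr2 mulrA ler_pM2r//.
apply: le_trans (normr_inner_le _ _) _.
apply: (@le_trans _ _ (d%:R * (e' * (t * B) + e' * (t * B)) * `|u|)).
  rewrite ler_wpM2r// ler_wpM2l//; apply: le_trans (ler_normB _ _) _.
  by rewrite lerD// ktB.
have -> : d%:R * (e' * (t * B) + e' * (t * B)) * `|u| = e' * (d%:R * 2 * B * `|u|) * t.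
  ring.
rewrite ler_pM2r// /e' mulrAC ler_pdivrMr// ler_pM2l//.
by rewrite lerDl.
Unshelve. all: by end_near. Qed.

(* Comparing the second difference of h along (u, v) with the one along (v, u),
   which is the same number, gives the symmetry without continuity of the Hessian. *)
Lemma hessian_sym h x u v :
  (forall y, differentiable h y) -> differentiable (grad h) x ->
  inner ('d (grad h) x u) v = inner ('d (grad h) x v) u.
Proof.
move=> dh dgh; apply/eqP; rewrite -subr_eq0 -normr_le0; apply/ler_addgt0Pr => e e0.
rewrite add0r.
have e20 : 0 < e / 2 by rewrite divr_gt0.
near (0 : R)^'+ => t.
have t0 : 0 < t by near: t; exact: nbhs_right_gt.
have huv : `|h (t *: u + (t *: v + x)) - h (t *: u + x) - h (t *: v + x) + h x
      - t ^+ 2 * inner ('d (grad h) x v) u| <= e / 2 * t ^+ 2.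
  by near: t; exact: second_difference.
have hvu : `|h (t *: v + (t *: u + x)) - h (t *: v + x) - h (t *: u + x) + h x
      - t ^+ 2 * inner ('d (grad h) x u) v| <= e / 2 * t ^+ 2.
  by near: t; exact: second_difference.
have t20 : 0 < t ^+ 2 by rewrite exprn_gt0.
rewrite -(ler_pM2r t20) -{1}(gtr0_norm t20) -normrM.
have -> : e * t ^+ 2 = e / 2 * t ^+ 2 + e / 2 * t ^+ 2 by field.
apply: le_trans (lerD huv hvu); apply: le_trans (ler_normB _ _).
rewrite [t *: v + (t *: u + x)]addrCA le_eqVlt; apply/orP; left; apply/eqP.
by congr (`|_|); ring.
Unshelve. all: by end_near. Qed.

(** By convexity the difference quotient from [x] towards [y] is at most [f y - f x] for every step
    in (0, 1]; the step then tends to 0 from the right. *)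
Lemma convex_grad_le f x y : convex_function [set: 'rV[R]_d] f ->
  differentiable f x -> inner (grad f x) (y - x) <= f y - f x.
Proof.
move=> cf df.
have dfl : is_derive_within setT (fun s => f (s *: (y - x) + x)) 0
    (inner (grad f x) (y - x)).
  have dl : is_derive_within setT (fun s => s *: (y - x) + x) 0 (y - x).
    exact: is_derive_within_line.
  by have := is_derive_within_grad _ dl; rewrite scale0r add0r; exact.
have /is_deriveP[/cvg_dnbhs_at_right] := dfl.
set l := lim _ => fl dl.
have {dl} dl : l = inner (grad f x) (y - x) by exact: dl.
rewrite -dl; apply: (ler_cvg_to fl (cvg_cst (f y - f x))).
near=> s.
have s0 : 0 < s by near: s; exact: nbhs_right_gt.
have s1 : s <= 1 by near: s; exact: nbhs_right_le.
rewrite [_ *: _]mulrC ler_pdivrMr//=.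
have := cf (Itv01 (ltW s0) s1) y x (mem_setT _) (mem_setT _).
rewrite convRE/= {1}/conv/= => fs.
have e : s *: (y - x) + x = s *: y + (1 - s) *: x.
  by rewrite scalerBr scalerBl scale1r addrA [RHS]addrAC.
rewrite e; apply: le_trans (lerD fs (lexx (- f x))) _.
by rewrite le_eqVlt; apply/orP; left; apply/eqP; rewrite /unstable.onem; ring.
Unshelve. all: by end_near. Qed.

End EuclideanTheory.

Arguments is_derive_within_line {R d} T x v t.

(** * Monotonicity from the sign of the relative derivative *)

Section Monotonicity.
Context {R : realType}.

(** Interior points of [a, b] are interior to [T], so the ordinary derivative test applies there; at
    [a] and [b], possibly endpoints of [T], one-sided continuity suffices and follows from relative
    differentiability. *)
Lemma is_derive_within_nonincreasing (T : set R) (g g' : R -> R) :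
  is_interval T -> (forall t, T t -> is_derive_within T g t (g' t)) ->
  (forall t, T t -> g' t <= 0) ->
  forall a b, T a -> T b -> a <= b -> g b <= g a.
Proof.
move=> Titv dg g'le0 a b Ta Tb; rewrite le_eqVlt => /predU1P[->//|ab].
have Tab s : a < s -> s < b -> T s by move=> sa sb; apply: (Titv a b) => //; rewrite !ltW.
have dgab s : s \in `]a, b[ -> is_derive s 1 g (g' s).
  move=> sab; have := sab; rewrite in_itv/= => /andP[sa sb].
  apply: (@is_derive_within_interior _ _ T) (dg _ (Tab _ sa sb)).
  have : \forall u \near s, u \in `]a, b[ by exact: near_in_itvoo.
  by apply: filterS => u; rewrite in_itv/= => /andP[ua ub]; exact: Tab.
apply: (@ler0_derive1_le_cc _ g a b); rewrite ?in_itv/= ?lexx ?(ltW ab)//.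
- by move=> s /dgab[].
- move=> s sab; rewrite derive1E; have -> := @derive_val _ _ _ _ _ _ _ (dgab _ sab).
  by apply: g'le0; move: sab; rewrite in_itv/= => /andP[sa sb]; exact: Tab.
- apply/continuous_within_itvP => //; split.
  + move=> s /dgab[dgs _]; apply: differentiable_continuous.
    exact/derivable1_diffP.
  (* Points just to the right of [a] lie in [T] and differ from [a], so the right-hand filter
     refines the relative one; the endpoint [b] is symmetric. *)
  + apply: cvg_trans (is_derive_within_cvg (dg _ Ta)); apply: cvg_app => A /= TA.
    near=> s.
    have sa : a < s by near: s; exact: nbhs_right_gt.
    have sb : s < b by near: s; exact: nbhs_right_lt.
    have : s != a -> T s -> A s by near: s; apply: cvg_within.
    by apply; [rewrite gt_eqF|exact: Tab].
  + apply: cvg_trans (is_derive_within_cvg (dg _ Tb)); apply: cvg_app => A /= TA.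
    near=> s.
    have sa : s < b by near: s; exact: nbhs_left_lt.
    have sb : a < s by near: s; exact: nbhs_left_gt.
    have : s != b -> T s -> A s by near: s; apply: cvg_within.
    by apply; [rewrite lt_eqF|exact: Tab].
Unshelve. all: by end_near. Qed.

End Monotonicity.

(** * Partial gradients of the Bregman Lagrangian, the Euler-Lagrange equation, and decay of the
    energy *)

Section BregmanLagrangian.
Context {R : realType} {d : nat}.
Implicit Types (f h : 'rV[R]_d -> R) (alpha beta gamma : R -> R).

(** The chain rule produces a factor [expR (- alpha t)], which cancels against the prefactor and
    leaves only [expR (gamma t)]. *)
Lemma grad_velocity_lagrangian f h alpha beta gamma Y V t :
  (forall y, differentiable h y) ->
  grad (fun W => bregman_lagrangian f h alpha beta gamma Y W t) V =
  expR (gamma t) *: (grad h (Y + expR (- alpha t) *: V) - grad h Y).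
Proof.
move=> dh; apply: grad_eq => v.
set c := expR (- alpha t).
have dY : is_derive_within setT (fun s => Y + c *: (s *: v + V)) 0 (c *: v).
  have := is_derive_withinD (is_derive_within_cst setT Y 0)
    (is_derive_withinZ (is_derive_within_cst setT c 0)
      (is_derive_within_line setT V v 0)).
  by rewrite scale0r addr0 add0r.
have dhY : is_derive_within setT (fun s => h (Y + c *: (s *: v + V))) 0
    (inner (grad h (Y + c *: V)) (c *: v)).
  by have := is_derive_within_grad (dh _) dY; rewrite scale0r add0r.
have dcst (r : R) := is_derive_within_cst setT r 0.
have := is_derive_withinM (dcst (expR (alpha t + gamma t)))
  (is_derive_withinB
    (is_derive_withinB (is_derive_withinB dhY (dcst (h Y)))
       (is_derive_within_inner (is_derive_within_cst setT (grad h Y) 0)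
         (is_derive_withinB dY (is_derive_within_cst setT Y 0))))
    (dcst (expR (beta t) * f Y))).
congr (is_derive_within _ _ _ _).
rewrite inner0l !mul0r !subr0 !addr0.
rewrite !innerZr innerZl innerBl -mulrBr mulrA /c -expRD.
by congr (expR _ * _); ring.
Qed.

Lemma grad_position_lagrangian f h alpha beta gamma Y V t :
  (forall y, differentiable f y) -> (forall y, differentiable h y) ->
  (forall y, differentiable (grad h) y) ->
  let W := expR (- alpha t) *: V in
  grad (fun y => bregman_lagrangian f h alpha beta gamma y V t) Y =
  expR (alpha t + gamma t) *:
    (grad h (Y + W) - grad h Y - 'd (grad h) Y W - expR (beta t) *: grad f Y).
Proof.
move=> df dh dgh W; apply: grad_eq => v.
have dY := is_derive_within_line setT Y v 0.
have dYW : is_derive_within setT (fun s => s *: v + Y + W) 0 v.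
  by have := is_derive_withinD dY (is_derive_within_cst setT W 0); rewrite addr0.
have dhY := is_derive_within_grad (dh _) dY.
have dhYW := is_derive_within_grad (dh _) dYW.
have dfY := is_derive_within_grad (df _) dY.
have dghY := is_derive_within_comp dY (dgh _).
have := is_derive_withinM (is_derive_within_cst setT (expR (alpha t + gamma t)) 0)
  (is_derive_withinB
    (is_derive_withinB (is_derive_withinB dhYW dhY)
       (is_derive_within_inner dghY (is_derive_within_cst setT W 0)))
    (is_derive_withinM (is_derive_within_cst setT (expR (beta t)) 0) dfY)).
rewrite !scale0r !add0r !mul0r !addr0 inner0r add0r.
(* Differentiating [grad h] in the pairing with [W] puts the Hessian on the test direction [v];
   symmetry moves it onto [W], giving the form of a gradient paired with [v]. *)
rewrite hessian_sym// innerZl !innerBl innerZl.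
apply: is_derive_within_eq => // s _.
rewrite /bregman_lagrangian /bregman_div -/W; congr (_ * (_ - inner _ _ - _)).
by rewrite addrC addKr.
Qed.

Lemma bregman_flow_euler_lagrange f h alpha beta gamma (T : set R) X :
  (forall y, differentiable f y) -> (forall y, differentiable h y) ->
  (forall y, differentiable (grad h) y) ->
  (forall t, T t -> is_derive_within T gamma t (expR (alpha t))) ->
  (forall t, T t -> derivable_within T X t) ->
  bregman_flow T f h alpha beta X <->
  euler_lagrange T (bregman_lagrangian f h alpha beta gamma) X.
Proof.
move=> df dh dgh dgamma dX.
rewrite /bregman_flow /euler_lagrange.
set X' := derive_within T X.
pose P s := grad h (X s + expR (- alpha s) *: X' s).
pose Q s := grad h (X s).
(* [P - Q], scaled by [expR (gamma s)], is the momentum, so the equivalence reduces to a pointwise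
   one between derivatives of [P] and of the momentum. *)
suff H t : T t ->
    is_derive_within T P t (- (expR (alpha t + beta t) *: grad f (X t))) <->
    is_derive_within T (fun s => expR (gamma s) *: (P s - Q s)) t
      (grad (fun Y => bregman_lagrangian f h alpha beta gamma Y (X' t) t) (X t)).
  split=> PQ t Tt.
    apply: is_derive_within_eq (proj1 (H t Tt) (PQ t Tt)) => // s _.
    by rewrite grad_velocity_lagrangian.
  apply/H => //; apply: is_derive_within_eq (PQ t Tt) => // s _.
  by rewrite grad_velocity_lagrangian.
move=> Tt; rewrite grad_position_lagrangian//= -/(P t) -/(Q t).
have dQ : is_derive_within T Q t ('d (grad h) (X t) (X' t)).
  by apply: is_derive_within_comp => //; exact: dX.
rewrite ['d (grad h) (X t) _]linearZ/=; move: dQ; set HX := 'd _ _ _ => dQ.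
have a0 := expR_gt0 (alpha t); have g0 := expR_gt0 (gamma t).
split=> [dP|dF].
  have := is_derive_withinZ (is_derive_within_expR (dgamma t Tt)) (is_derive_withinB dP dQ).
  congr (is_derive_within _ _ _ _); apply/rowP => i; rewrite !mxE !expRD expRN.
  by field; rewrite gt_eqF.
(* Conversely, [P] is recovered as [expR (- gamma s)] times the momentum plus [Q], hence is
   differentiable. *)
have dNg := is_derive_within_expR (is_derive_withinN (dgamma t Tt)).
have := is_derive_withinD (is_derive_withinZ dNg dF) dQ.
set D := (X in is_derive_within _ _ _ X -> _).
suff <- : D = - (expR (alpha t + beta t) *: grad f (X t)).
  apply: is_derive_within_eq => // s _.
  by rewrite scalerA -expRD addNr expR0 scale1r subrK.
rewrite /D; apply/rowP => i; rewrite !mxE !expRD !expRN.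
by field; rewrite !gt_eqF.
Qed.

Lemma bregman_div_ge0 h x y : convex_function [set: 'rV[R]_d] h ->
  differentiable h x -> 0 <= bregman_div h y x.
Proof. by move=> ch dh; rewrite subr_ge0; exact: convex_grad_le. Qed.

(* Along the flow the first-order terms of the two summands in the velocity
   cancel, and what remains is at most
   exp beta * (db - exp alpha) * (f X - f xstar), by convexity of f. *)
Lemma bregman_lyapunov_derive f h alpha beta (T : set R) X xstar t db :
  convex_function [set: 'rV[R]_d] f -> (forall y, differentiable f y) ->
  (forall y, f xstar <= f y) -> (forall y, differentiable h y) ->
  derivable_within T alpha t -> is_derive_within T beta t db ->
  db <= expR (alpha t) -> C2_within T X -> bregman_flow T f h alpha beta X ->
  T t ->
  let Z s := X s + expR (- alpha s) *: derive_within T X s in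
  exists2 l, l <= 0 & is_derive_within T (fun s =>
    bregman_div h xstar (Z s) + expR (beta s) * (f (X s) - f xstar)) t l.
Proof.
move=> cf df fmin dh dalpha dbeta db_le [dX [ddX _]] flow Tt Z.
have dX' := dX t Tt.
(* Mere existence of the velocity of [Z] is enough: its contributions through [h (Z s)] and through
   [xstar - Z s] cancel. *)
have [Z' dZ] : exists Z', is_derive_within T Z t Z'.
  eexists; apply: is_derive_withinD; first exact: dX'.
  apply: is_derive_withinZ; last exact: (ddX t Tt).
  by apply: is_derive_within_expR; apply: is_derive_withinN; exact: dalpha.
have dZs := is_derive_withinB (is_derive_within_cst T xstar t) dZ.
have dD := is_derive_withinB
  (is_derive_withinB (is_derive_within_cst T (h xstar) t)
     (is_derive_within_grad (dh _) dZ))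
  (is_derive_within_inner (flow t Tt) dZs).
have dF := is_derive_withinM (is_derive_within_expR dbeta)
  (is_derive_withinB (is_derive_within_grad (df _) dX') (is_derive_within_cst T (f xstar) t)).
eexists; last exact: is_derive_withinD dD dF.
rewrite -/(Z t) !sub0r subr0 innerNr innerNl innerZl opprB [- _ + _]addrC subrK.
set X' := derive_within T X t.
have -> : xstar - Z t = (xstar - X t) - expR (- alpha t) *: X' by rewrite opprD addrA.
have conv := convex_grad_le xstar cf (df (X t)).
rewrite innerBr innerZr -/X'.
move: conv; set p := inner _ (xstar - _); set q := inner _ X'.
have fX := fmin (X t); move=> conv.
rewrite expRD expRN.
have a0 := expR_gt0 (alpha t); have b0 := expR_gt0 (beta t).
have -> : expR (alpha t) * expR (beta t) * (p - (expR (alpha t))^-1 * q) +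
   (expR (beta t) * q + expR (beta t) * db * (f (X t) - f xstar)) =
   expR (beta t) * (expR (alpha t) * p + db * (f (X t) - f xstar)).
  by field; rewrite gt_eqF.
rewrite pmulr_rle0//.
have : expR (alpha t) * p <= expR (alpha t) * (f xstar - f (X t)).
  by rewrite ler_pM2l.
have : db * (f (X t) - f xstar) <= expR (alpha t) * (f (X t) - f xstar).
  by rewrite ler_wpM2r// subr_ge0.
lra.
Qed.

End BregmanLagrangian.

(** * The equivalence with Euler-Lagrange and the convergence rate *)

Unset Implicit Arguments.
Set Strict Implicit.

Theorem theorem2p1 (R : realType) (d : nat)
    (f h : 'rV[R]_d -> R) (xstar : 'rV[R]_d)
    (f_C1 : C1 f) (f_convex : convex_function [set: 'rV[R]_d] f)
    (f_min : unique_minimizer f xstar)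
    (h_dgf : distance_generating h)
    (T : set R) (T_itv : is_interval T)
    (alpha beta gamma : R -> R)
    (alpha_C1 : C1_within T alpha) (beta_C1 : C1_within T beta)
    (gamma_C1 : C1_within T gamma)
    (gamma_scaling : forall t, T t -> derive_within T gamma t = expR (alpha t))
    (X : R -> 'rV[R]_d) (X_C2 : C2_within T X) :
  (bregman_flow T f h alpha beta X <->
   euler_lagrange T (bregman_lagrangian f h alpha beta gamma) X) /\
  ((forall t, T t -> derive_within T beta t <= expR (alpha t)) ->
   bregman_flow T f h alpha beta X ->
   forall t0, T t0 ->
     exists2 K : R, 0 <= K &
       forall t, T t -> t0 <= t -> f (X t) - f xstar <= K * expR (- beta t)).
Proof.
have [df _] := f_C1; have [fmin _] := f_min.
have [ch [[dh _] _] dgh] := h_dgf.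
split.
  apply: bregman_flow_euler_lagrange => //; last by case: X_C2.
  by move=> t Tt; rewrite -gamma_scaling//; exact: (proj1 gamma_C1).
move=> beta_scaling flow t0 Tt0.
pose Z s := X s + expR (- alpha s) *: derive_within T X s.
pose E s := bregman_div h xstar (Z s) + expR (beta s) * (f (X s) - f xstar).
have /choice[E' dE] (t : R) : exists l, T t -> l <= 0 /\ is_derive_within T E t l.
  (* The value 0 is a placeholder for times outside [T]. *)
  have [Tt|//] := pselect (T t); last by exists 0.
  have [l l0 dl] := bregman_lyapunov_derive f_convex df fmin dh (proj1 alpha_C1 t Tt)
    (proj1 beta_C1 t Tt) (beta_scaling t Tt) X_C2 flow Tt.
  by exists l.
have Enoninc := is_derive_within_nonincreasing T_itv
  (fun t Tt => proj2 (dE t Tt)) (fun t Tt => proj1 (dE t Tt)).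
exists (E t0) => [|t Tt t0t].
  rewrite addr_ge0 ?bregman_div_ge0// mulr_ge0 ?expR_ge0// subr_ge0//.
rewrite expRN ler_pdivlMr ?expR_gt0// mulrC.
(* Since the divergence is nonnegative, [expR (beta t) * (f (X t) - f xstar)] is at most [E t],
   hence at most [E t0]. *)
apply: le_trans (Enoninc t0 t Tt0 Tt t0t).
by rewrite lerDr bregman_div_ge0.
Qed.
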